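(* For real numbers $a,b>-1$ with $b\neq 1$, the function $$Q_{a,b}(w,z)=\frac{1}{1-b}\int_0^{z\wedge w}s^{a}\left[(z-s)^{b}+(w-s)^{b}-(w+z-2s)^{b}\right]ds,\qquad w,z\ge 0,$$ is positive definite in each of the following cases: (i) $a>-1$ and $0\le b\le 2$ (with $b\ne 1$); (ii) $a>-1$ and $-1<b<0$ with $a+b+1\ge 0$.
   Context: $z\wedge w=\min(z,w)$. ''Positive definite'' is meant in the sense of covariance functions: $Q$ is symmetric and $\sum_{i,j=1}^n c_ic_jQ(t_i,t_j)\ge 0$ for all $n\ge1$, $t_1,\dots,t_n\ge 0$ and $c_1,\dots,c_n\in\mathbb{R}$; equivalently, $Q$ is the covariance function of a centered real-valued Gaussian process indexed by $[0,\infty)$. *)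

(* Defs.v *)
From HB Require Import structures.
From mathcomp Require Import all_boot all_order all_algebra.
From mathcomp Require Import all_classical all_reals all_analysis.
Import Order.TTheory GRing.Theory Num.Theory.
Import numFieldNormedType.Exports.

Set Implicit Arguments.
Unset Strict Implicit.
Unset Printing Implicit Defensive.

Local Open Scope classical_set_scope.
Local Open Scope ring_scope.

(* A Lebesgue integral over the open interval: all the bases of the powers are
   positive there, so the convention for [0 `^ b] plays no role. *)
Definition Q (R : realType) (a b : R) (w z : R) : R :=
  (1 - b)^-1 *
  \int[@lebesgue_measure R]_(s in `]0, Num.min z w[)
     (s `^ a * ((z - s) `^ b + (w - s) `^ b - (w + z - s *+ 2) `^ b)).

(* "Positive definite" in the sense of covariance functions on [0, +oo[, i.e.
   with a non-strict inequality. *)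
Definition positive_definite (R : realType) (K : R -> R -> R) : Prop :=
  (forall s t : R, 0 <= s -> 0 <= t -> K s t = K t s) /\
  (forall (n : nat) (t c : 'I_n -> R), (1 <= n)%N -> (forall i, 0 <= t i) ->
     0 <= \sum_(i < n) \sum_(j < n) c i * c j * K (t i) (t j)).

(* Main.v *)
Require Import Defs.
From HB Require Import structures.
From mathcomp Require Import all_boot all_order all_algebra.
From mathcomp Require Import all_classical all_reals all_analysis.
From mathcomp Require Import measurable_realfun ring lra.
Import Order.TTheory GRing.Theory Num.Theory.
Import numFieldNormedType.Exports.

(** Write [k_b(x, y) = (x^b + y^b - (x + y)^b) / (1 - b)], so that
    [Q_{a,b}(w, z)] is the integral of [s^a k_b(w - s, z - s)] over
    [0 < s < min(w, z)]. The two ranges of [b] need different arguments.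

    If [0 <= b <= 2], the kernel [k_b] is itself positive definite, and [Q] is a
    mixture of positive definite kernels with nonnegative weights [s^a]. For
    [b = 0] and [b = 2] the kernel has rank one. For [0 < b < 2] it is a positive
    multiple of
    [[
      J(x, y) = int_0^oo (1 - e^{-xu}) (1 - e^{-yu}) u^{-1-b} du,
    ]]
    visibly positive definite. This is proved without evaluating any integral:
    with [X = e^{-xu}] and [Y = e^{-yu}], the identity
    [[
      (1-X)^2 + (1-Y)^2 + (1-X^2)(1-Y^2) = 2(1-X)(1-Y) + (1-XY)^2
    ]]
    gives [J(x,x) + J(y,y) + J(2x,2y) = 2J(x,y) + J(x+y,x+y)], and the homogeneity
    [J(kx,ky) = k^b J(x,y)] turns it into
    [(2 - 2^b) J(x,y) = J(1,1) (x^b + y^b - (x+y)^b)]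
    (lemma [levy_integral_power_kernel]); finally [2 - 2^b] and [1 - b] have the
    same sign. This treats [b < 1] and [b > 1] alike.

    If [b < 0], [k_b] is no longer positive definite and the argument is about
    increments. For [w <= w' <= z <= z'] the rectangular increment
    [Q(w',z') - Q(w,z') - Q(w',z) + Q(w,z)] is nonpositive (lemma
    [Q_increment_le0], a consequence of the monotonicity of
    [x |-> x^b - (x+h)^b]): in terms of a process with covariance [Q], increments
    over disjoint intervals are nonpositively correlated. Moreover [Q(w, z)] is
    nondecreasing in [w <= z] (lemma [Q_mono]): this is where [a + b + 1 >= 0]
    enters, through [int_0^w s^a (w-s)^b ds = w^{a+b+1} B(a+1, b+1)]. Hence the
    matrix of the rectangular increments over a grid has nonpositive off-diagonal
    entries and nonnegative row sums; such a diagonally dominant matrix is positive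
    semidefinite (lemmas [diagonally_dominant_ge0] and
    [nonpositive_increments_psd]). *)

Set Implicit Arguments.
Unset Strict Implicit.
Unset Printing Implicit Defensive.

Local Open Scope classical_set_scope.
Local Open Scope ring_scope.

(** * Kernels with nonpositively correlated increments *)

(** Since [2 C_k C_l = C_k^2 + C_l^2 - (C_k - C_l)^2] and [D] is symmetric, the
    quadratic form equals the sum of [C_k^2] times the row sums, minus half the
    sum of the [(C_k - C_l)^2 D_kl], in which the diagonal does not contribute. *)
Lemma diagonally_dominant_ge0 (R : realFieldType) (N : nat)
    (D : 'I_N -> 'I_N -> R) (C : 'I_N -> R) :
  (forall k l, D k l = D l k) ->
  (forall k l, k != l -> D k l <= 0) ->
  (forall k, 0 <= \sum_(l < N) D k l) ->
  0 <= \sum_(k < N) \sum_(l < N) C k * C l * D k l.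
Proof.
move=> Dsym Doff Drow.
pose S := \sum_(k < N) C k ^+ 2 * \sum_(l < N) D k l.
have S_ge0 : 0 <= S by apply: sumr_ge0 => k _; rewrite mulr_ge0 ?sqr_ge0.
have SE : S = \sum_(k < N) \sum_(l < N) C k ^+ 2 * D k l.
  by apply: eq_bigr => k _; rewrite mulr_sumr.
have SE' : S = \sum_(k < N) \sum_(l < N) C l ^+ 2 * D k l.
  rewrite SE exchange_big/=; apply: eq_bigr => k _.
  by apply: eq_bigr => l _; rewrite Dsym.
have -> : \sum_(k < N) \sum_(l < N) C k * C l * D k l =
    S + \sum_(k < N) \sum_(l < N) (- (2^-1 * (C k - C l) ^+ 2 * D k l)).
  have -> : S = \sum_(k < N) \sum_(l < N)
      (2^-1 * (C k ^+ 2 * D k l) + 2^-1 * (C l ^+ 2 * D k l)).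
    transitivity (2^-1 * S + 2^-1 * S); first by field.
    rewrite {1}SE SE' !mulr_sumr -big_split; apply: eq_bigr => k _ /=.
    by rewrite !mulr_sumr -big_split.
  rewrite -big_split; apply: eq_bigr => k _ /=.
  by rewrite -big_split; apply: eq_bigr => l _ /=; field.
apply: addr_ge0 => //; apply: sumr_ge0 => k _; apply: sumr_ge0 => l _.
have [->|kl] := eqVneq k l; first by rewrite subrr expr0n/= mulr0 mul0r oppr0.
by rewrite -mulrN mulr_ge0 ?oppr_ge0 ?Doff// mulr_ge0 ?invr_ge0 ?sqr_ge0.
Qed.

Definition rect_increment (R : zmodType) (K : R -> R -> R) (w w' z z' : R) : R :=
  K w' z' - K w z' - K w' z + K w z.

Lemma sum_rect_increment (R : zmodType) (K : R -> R -> R) (u : nat -> R) (p q : nat) :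
  (forall k, K (u 0%N) (u k) = 0) -> (forall k, K (u k) (u 0%N) = 0) ->
  \sum_(0 <= k < p) \sum_(0 <= l < q) rect_increment K (u k) (u k.+1) (u l) (u l.+1) =
  K (u p) (u q).
Proof.
move=> K0l K0r.
have row k : \sum_(0 <= l < q) rect_increment K (u k) (u k.+1) (u l) (u l.+1) =
    K (u k.+1) (u q) - K (u k) (u q).
  pose f l := K (u k.+1) (u l) - K (u k) (u l).
  rewrite (eq_bigr (fun l => f l.+1 - f l)).
    by rewrite telescope_sumr// /f !K0r !subr0.
  by move=> l _; rewrite /rect_increment /f opprB -!addrA; congr (_ + (_ + _)); rewrite addrC.
under eq_bigr do rewrite row.
by rewrite (@telescope_sumr _ 0 p (fun k => K (u k) (u q)))// K0l subr0.
Qed.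

(** The points [t i] come unsorted and possibly repeated; they are read off a
    nondecreasing grid [u] starting at [0], at ranks [r i]. *)
Lemma increasing_grid (R : realDomainType) (n : nat) (t : 'I_n -> R) :
  (forall i, 0 <= t i) ->
  exists (u : nat -> R) (r : 'I_n -> nat),
   [/\ u 0%N = 0, forall k, 0 <= u k, forall i, (r i <= n)%N,
     forall i, t i = u (r i) & forall k l, (k <= l <= n)%N -> u k <= u l].
Proof.
move=> t0; pose s := 0 :: sort <=%R [seq t i | i : 'I_n].
have size_s : size s = n.+1 by rewrite /s/= size_sort size_map size_enum_ord.
have s_ge0 x : x \in s -> 0 <= x.
  by rewrite inE mem_sort => /predU1P[->//|/mapP[i _ ->]].
have s_sorted : sorted <=%R s.
  rewrite /s /= path_min_sorted; first exact: sort_le_sorted.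
  by apply/allP => x xs; apply: s_ge0; rewrite inE xs orbT.
have ts i : t i \in s by rewrite /s inE mem_sort map_f ?orbT// mem_enum.
exists (fun k => nth 0 s k), (fun i => index (t i) s); split => //.
- move=> k; have [ks|ks] := ltnP k (size s); last by rewrite nth_default.
  exact/s_ge0/mem_nth.
- by move=> i; rewrite -ltnS -size_s index_mem.
- by move=> i; rewrite nth_index.
- move=> k l /andP[kl ln].
  apply: (sorted_leq_nth le_trans le_refl) => //; rewrite inE size_s ltnS //.
  exact: leq_trans ln.
Qed.

(** On a grid containing the points, [K (t i) (t j)] is the sum of the rectangular
    increments [D k l] below the ranks of [i] and [j], so that the form in [c] is
    the form of [D] in the cumulated weights [C k]. The hypotheses on [K] make
    [D] diagonally dominant: a row of [D] telescopes to an increment of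
    [K _ (u n)]. *)
Lemma nonpositive_increments_psd (R : realFieldType) (K : R -> R -> R) :
  (forall z, 0 <= z -> K 0 z = 0) ->
  (forall w z, 0 <= w -> 0 <= z -> K w z = K z w) ->
  (forall w w' z z', 0 <= w -> w <= w' -> w' <= z -> z <= z' ->
     rect_increment K w w' z z' <= 0) ->
  (forall w w' z, 0 <= w -> w <= w' -> w' <= z -> K w z <= K w' z) ->
  forall (n : nat) (t c : 'I_n -> R), (forall i, 0 <= t i) ->
  0 <= \sum_(i < n) \sum_(j < n) c i * c j * K (t i) (t j).
Proof.
move=> K0 Ksym Kincr Kmon n t c t0.
have [u [r [u0 u_ge0 rn tE u_incr]]] := increasing_grid t0.
have K0l k : K (u 0%N) (u k) = 0 by rewrite u0 K0.
have K0r k : K (u k) (u 0%N) = 0 by rewrite Ksym.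
pose D (k l : nat) := rect_increment K (u k) (u k.+1) (u l) (u l.+1).
have Dsym k l : D k l = D l k.
  rewrite /D /rect_increment (Ksym (u k.+1) (u l.+1))// (Ksym (u k) (u l.+1))//.
  by rewrite (Ksym (u k.+1) (u l))// (Ksym (u k) (u l))//; congr (_ + _); rewrite addrAC.
pose C (k : 'I_n) := \sum_(i < n) c i * (k < r i)%N%:R.
have sumE (p : nat) (F : nat -> R) : (p <= n)%N ->
    \sum_(0 <= k < p) F k = \sum_(k < n) (k < p)%N%:R * F k.
  move=> pn; rewrite big_mkord (big_ord_widen _ _ pn) big_mkcond/=.
  by apply: eq_bigr => k _; case: ifP; rewrite (mul1r, mul0r).
have KE i j : K (t i) (t j) =
    \sum_(k < n) \sum_(l < n) (k < r i)%N%:R * ((l < r j)%N%:R * D k l).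
  rewrite !tE -(sum_rect_increment (r i) (r j) K0l K0r) sumE//.
  by apply: eq_bigr => k _; rewrite sumE// mulr_sumr.
suff -> : \sum_(i < n) \sum_(j < n) c i * c j * K (t i) (t j) =
    \sum_(k < n) \sum_(l < n) C k * C l * D k l.
  apply: diagonally_dominant_ge0.
  - exact: Dsym.
  - move=> k l kl; wlog {kl} kl : k l / (k < l)%N.
      move=> wl; have [/wl//|lk|/val_inj kl'] := ltngtP k l.
        by rewrite Dsym; exact: wl.
      by rewrite kl' eqxx in kl.
    apply: Kincr; [exact: u_ge0|apply: u_incr..].
    + by rewrite leqnSn ltn_ord.
    + by rewrite kl ltnW.
    + by rewrite leqnSn ltn_ord.
  - move=> k; rewrite -(big_mkord xpredT (D k)).
    pose f l := K (u k.+1) (u l) - K (u k) (u l).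
    rewrite (eq_bigr (fun l => f l.+1 - f l)); last first.
      move=> l _; rewrite /D /rect_increment /f opprB -!addrA.
      by congr (_ + (_ + _)); rewrite addrC.
    rewrite telescope_sumr// /f !K0r !subr0 subr_ge0.
    by apply: Kmon => //; apply: u_incr; rewrite ?leqnSn ?leqnn ltn_ord.
transitivity (\sum_(i < n) \sum_(k < n) \sum_(j < n) \sum_(l < n)
    c i * (k < r i)%N%:R * (c j * (l < r j)%N%:R) * D k l).
  apply: eq_bigr => i _; rewrite exchange_big/=; apply: eq_bigr => j _.
  rewrite KE mulr_sumr; apply: eq_bigr => k _; rewrite mulr_sumr.
  by apply: eq_bigr => l _; ring.
rewrite exchange_big; apply: eq_bigr => k _ /=.
under eq_bigr do rewrite exchange_big/=.
rewrite exchange_big; apply: eq_bigr => l _ /=.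
rewrite /C big_distrlr/= mulr_suml; apply: eq_bigr => i _.
by rewrite mulr_suml.
Qed.

(** * Integrals of finite sums and affine changes of variables *)

Section finite_sums.
Context d (T : measurableType d) (R : realType) (mu : {measure set T -> \bar R}).

Lemma Rintegral_sum (D : set T) (I : Type) (s : seq I) (f : I -> T -> R) :
  measurable D -> (forall i, mu.-integrable D (EFin \o f i)) ->
  \int[mu]_(x in D) (\sum_(i <- s) f i x) = \sum_(i <- s) \int[mu]_(x in D) f i x.
Proof.
move=> mD fi; rewrite /Rintegral.
under eq_integral do rewrite -sumEFin.
rewrite integral_sum// sum_fine// => i _.
exact: (integrable_fin_num mD (fi i)).
Qed.

(** Integration commutes with the finite quadratic form, so mixing preserves
    positive semidefiniteness. *)
Lemma Rintegral_quad_ge0 (D : set T) n (c : 'I_n -> R)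
    (K : 'I_n -> 'I_n -> T -> R) :
  measurable D -> (forall i j, mu.-integrable D (EFin \o K i j)) ->
  (forall s, D s -> 0 <= \sum_(i < n) \sum_(j < n) c i * c j * K i j s) ->
  0 <= \sum_(i < n) \sum_(j < n) c i * c j * \int[mu]_(s in D) K i j s.
Proof.
move=> mD Ki K0.
have cKi i j : mu.-integrable D (EFin \o (fun s => c i * c j * K i j s)).
  rewrite (_ : _ \o _ = (fun s => ((c i * c j)%:E * (EFin \o K i j) s)%E)).
    exact: integrableZl.
  by apply/funext => s /=; rewrite EFinM.
rewrite (_ : \sum_(i < n) _ =
    \int[mu]_(s in D) \sum_(i < n) \sum_(j < n) c i * c j * K i j s).
  exact: Rintegral_ge0.
rewrite Rintegral_sum// => [|i]; last first.
  rewrite (_ : _ \o _ =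
    (fun s => \sum_(j <- index_enum 'I_n) ((c i * c j * K i j s)%:E))%E).
    by apply: integrable_sum => // j _; exact: cKi.
  by apply/funext => s /=; rewrite sumEFin.
apply: eq_bigr => i _; rewrite Rintegral_sum//.
by apply: eq_bigr => j _; rewrite RintegralZl.
Qed.

End finite_sums.

Section integrals.
Context {R : realType}.
Notation mu := (@lebesgue_measure R).

(** Comparison of integrals whose upper bound moves together with the integrand. *)
Lemma le_Rintegral_extend (w w' : R) (f g : R -> R) : w <= w' ->
  mu.-integrable `]0, w[ (EFin \o f) -> mu.-integrable `]0, w'[ (EFin \o g) ->
  (forall s, 0 < s < w -> f s <= g s) ->
  (forall s, w <= s < w' -> 0 <= g s) ->
  \int[mu]_(s in `]0, w[) f s <= \int[mu]_(s in `]0, w'[) g s.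
Proof.
move=> ww' fi gi fg g0.
have ww : `]0, w'[%classic `&` `]0, w[%classic = `]0, w[%classic :> set R.
  apply/setIidr => s /=; rewrite !in_itv/= => /andP[-> /=].
  by move=> /lt_le_trans; apply.
rewrite -{1}ww Rintegral_mkcondr; apply: le_Rintegral => //.
  rewrite -restrict_EFin; apply/integrable_restrict => //.
  by rewrite ww.
move=> s /=; rewrite in_itv/= patchE => /andP[s0 sw'].
case: ifPn; rewrite (inE, notin_setE)/= in_itv/= s0/= => sw.
  by rewrite fg// s0.
by rewrite g0// sw' andbT leNgt; apply/negP.
Qed.

Lemma measurable_affine (k c : R) :
  measurable_fun [set: measurableTypeR R] (fun x => k * x + c : measurableTypeR R).
Proof. by apply: measurable_funD => //; exact: measurable_funM. Qed.

(** The image of [mu] is a measure by virtue of the measurability of the map, so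
    its measure structure is applied to that proof. *)
Let affine_measure (k c : R) : {measure set (measurableTypeR R) -> \bar R} :=
  mscale `|k|%:nng
    (measure_function_pushforward__canonical__measure_function_Measure mu
      (measurable_affine k c)).

(** By uniqueness of Lebesgue measure it is enough to compare on half-open
    intervals from [x] to [y], whose preimages are intervals of length [(y - x) / |k|]. *)
Lemma lebesgue_measure_affine (k c : R) (k0 : k != 0) (A : set (measurableTypeR R)) :
  measurable A -> mu A = affine_measure k c A.
Proof.
move: A; apply: lebesgue_measure_unique => //= _ [[x y]] _ <-.
rewrite /affine_measure/= /mscale/= /pushforward/= lebesgue_measure_itv/=.
have [kn|kp|/eqP] := ltgtP k 0; last by rewrite (negbTE k0).
- have -> : (fun z => k * z + c) @^-1` `]x, y] =
      `[(y - c) / k, (x - c) / k[%classic.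
    apply/seteqP; split => z /=; rewrite !in_itv/= -ltrBlDr -lerBrDr.
      by rewrite ler_ndivrMr// ltr_ndivlMr// ![z * k]mulrC andbC.
    by rewrite ler_ndivrMr// ltr_ndivlMr// ![z * k]mulrC andbC.
  rewrite lebesgue_measure_itv/= !lte_fin ltr_ndivrMr// divfK ?lt_eqF// ltrD2r.
  case: ifPn => _; last by rewrite mule0.
  by rewrite -!EFinB -EFinM; congr EFin; rewrite ltr0_norm//; field; rewrite lt_eqF.
- have -> : (fun z => k * z + c) @^-1` `]x, y] =
      `](x - c) / k, (y - c) / k]%classic.
    apply/seteqP; split => z /=; rewrite !in_itv/= -ltrBlDr -lerBrDr.
      by rewrite ler_pdivlMr// ltr_pdivrMr// ![z * k]mulrC.
    by rewrite ler_pdivlMr// ltr_pdivrMr// ![z * k]mulrC.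
  rewrite lebesgue_measure_itv/= !lte_fin ltr_pdivrMr// divfK ?gt_eqF// ltrD2r.
  case: ifPn => _; last by rewrite mule0.
  by rewrite -!EFinB -EFinM; congr EFin; rewrite gtr0_norm//; field; rewrite gt_eqF.
Qed.

Lemma ge0_integral_affine (k c : R) (D : set (measurableTypeR R))
    (f : measurableTypeR R -> \bar R) : k != 0 ->
  measurable D -> measurable_fun D f -> (forall x, D x -> 0 <= f x)%E ->
  (\int[mu]_(x in D) f x =
   `|k|%:E * \int[mu]_(x in (fun x => (k * x + c)%R) @^-1` D) f (k * x + c)%R)%E.
Proof.
move=> k0 mD mf f0.
rewrite (eq_measure_integral (affine_measure k c)); last first.
  by move=> A mA _; exact: lebesgue_measure_affine.
rewrite ge0_integral_mscale//=; congr (_ * _)%E.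
rewrite ge0_integral_pushforward//.
  exact: measurable_affine.
by move=> x /[!inE]; exact: f0.
Qed.

Lemma integrable_affine (k c : R) (D : set (measurableTypeR R)) (f : R -> R) :
  k != 0 -> measurable D -> (forall x, D x -> 0 <= f x) ->
  mu.-integrable D (EFin \o f) ->
  mu.-integrable ((fun x => k * x + c) @^-1` D) (fun x => (f (k * x + c))%:E).
Proof.
move=> k0 mD f0 fi; have [mf fint] := integrableP _ _ _ fi.
have mk := measurable_affine k c.
have mDk : measurable ((fun x => k * x + c) @^-1` D : set (measurableTypeR R)).
  by rewrite -[X in measurable X]setTI; exact: mk.
apply/integrableP; split.
  apply: (measurable_comp mD _ mf); last exact: measurable_funS mk.
  by move=> _ [x Dx <-].
have k1 : (0 < `|k|%:E)%E by rewrite lte_fin normr_gt0.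
rewrite -(@lte_pmul2l _ `|k|%:E)// mulry gtr0_sg ?normr_gt0// mul1e.
rewrite -(@ge0_integral_affine k c D (fun x => `|(f x)%:E|%E))//.
exact: measurableT_comp.
Qed.

Lemma Rintegral_affine (k c : R) (D : set (measurableTypeR R)) (f : R -> R) :
  k != 0 -> measurable D -> (forall x, D x -> 0 <= f x) ->
  mu.-integrable D (EFin \o f) ->
  \int[mu]_(x in D) f x =
  `|k| * \int[mu]_(x in (fun x => k * x + c) @^-1` D) f (k * x + c).
Proof.
move=> k0 mD f0 fi.
rewrite /Rintegral (@ge0_integral_affine k c)//; last exact: measurable_int fi.
rewrite fineM//; apply: integrable_fin_num; last exact: integrable_affine.
by rewrite -[X in measurable X]setTI; exact: measurable_affine.
Qed.

End integrals.

(** * Integrability of powers *)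

Lemma integrable_dominated (R : realType) (D : set (measurableTypeR R)) (g f : R -> R) :
  measurable D -> measurable_fun D f -> (forall x, D x -> `|f x| <= g x) ->
  (@lebesgue_measure R).-integrable D (EFin \o g) ->
  (@lebesgue_measure R).-integrable D (EFin \o f).
Proof.
move=> mD mf fg; apply: le_integrable => //; first exact/measurable_EFinP.
by move=> x Dx /=; rewrite lee_fin (le_trans (fg x Dx)) ?ler_norm.
Qed.

Lemma integrable_disjointU d (T : measurableType d) (R : realType)
    (mu : {measure set T -> \bar R}) (A B : set T) (f : T -> \bar R) :
  measurable A -> measurable B -> [disjoint A & B] ->
  mu.-integrable A f -> mu.-integrable B f -> mu.-integrable (A `|` B) f.
Proof.
move=> mA mB AB /integrableP[mfA fA] /integrableP[mfB fB].
have mf : measurable_fun (A `|` B) f by apply/measurable_funU.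
apply/integrableP; split => //.
rewrite ge0_integral_setU//; first exact: lte_add_pinfty.
exact: measurableT_comp.
Qed.

Section powers.
Context {R : realType}.
Notation mu := (@lebesgue_measure R).

Lemma integral_powR (p x y : R) : p != -1 -> 0 < x -> x < y ->
  (\int[mu]_(u in `[x, y]) (u `^ p)%:E =
   ((y `^ (p + 1) - x `^ (p + 1)) / (p + 1))%:E)%E.
Proof.
move=> p1 x0 xy.
have p10 : p + 1 != 0 by rewrite addr_eq0.
pose F (u : R) := (p + 1)^-1 * u `^ (p + 1).
have dF (u : R) : 0 < u -> is_derive u 1 F (u `^ p).
  move=> u0; rewrite /F.
  rewrite [X in is_derive _ _ _ X](_ : _ = (p + 1)^-1 *: ((p + 1) * u `^ (p + 1 - 1))).
    by apply: is_deriveZ; exact: is_derive1_powR.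
  by rewrite scalerA mulVf// scale1r addrK.
have cF (u : R) : 0 < u -> {for u, continuous F}.
  move=> /dF[/derivable1_diffP dFu _]; exact: differentiable_continuous.
rewrite (@continuous_FTC2 _ _ F) => //.
- by rewrite -EFinB -mulrBr mulrC.
- apply: continuous_in_subspaceT => u; rewrite inE/= in_itv/= => /andP[xu _].
  have u0 := lt_le_trans x0 xu.
  have [] := @is_derive1_powR R p u u0 => /derivable1_diffP + _.
  exact: differentiable_continuous.
- split.
  + by move=> u; rewrite in_itv/= => /andP[/(lt_trans x0)/dF[]].
  + exact/cvg_at_right_filter/cF.
  + exact/cvg_at_left_filter/cF/(lt_trans x0).
- move=> u; rewrite in_itv/= => /andP[/(lt_trans x0)/dF[_ <-] _].
  by rewrite derive1E.
Qed.

(** Monotone convergence, as a criterion for improper integrals: bounded integrals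
    over an exhausting sequence give integrability over the union. *)
Lemma integrable_bigcup_bounded (F : (set (measurableTypeR R))^nat) (f : R -> R) (M : R) :
  nondecreasing_seq F -> (forall n, measurable (F n)) ->
  measurable_fun setT f -> (forall x, 0 <= f x) ->
  (forall n, \int[mu]_(x in F n) (f x)%:E <= M%:E)%E ->
  mu.-integrable (\bigcup_n F n) (EFin \o f).
Proof.
move=> Fnd mF mf f0 FM.
have mfF D : measurable_fun D (EFin \o f : measurableTypeR R -> \bar R).
  by apply/measurable_EFinP; exact: measurable_funS mf.
apply/integrableP; split => //.
under eq_integral do rewrite gee0_abs ?lee_fin//.
have cvgF := @ge0_nondecreasing_set_cvg_integral _ _ _ F (EFin \o f) mu Fnd mF
  (fun i => mfF _) (fun i x _ => f0 x).
rewrite -(cvg_lim _ cvgF)//; apply: (@le_lt_trans _ _ M%:E); last exact: ltry.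
by apply: lime_le; [apply/cvg_ex; eexists; exact: cvgF|exact: nearW].
Qed.

Lemma integrable_powR0 (p m : R) : -1 < p ->
  mu.-integrable `]0, m[ (fun u => (u `^ p)%:E).
Proof.
move=> p1; have [m0|m0] := leP m 0.
  by rewrite set_itv_ge ?bnd_simp -?leNgt//; exact: integrable_set0.
have p10 : 0 < p + 1 by rewrite -ltrBlDr sub0r.
apply: (@integrableS _ _ _ mu `]0, m]) => //.
  by apply: subset_itvl; rewrite bnd_simp.
rewrite itv_open_bnd_bigcup.
apply: (@integrable_bigcup_bounded _ _ (m `^ (p + 1) / (p + 1))) => //.
- move=> i j ij; apply/subsetPset/subset_itvr; rewrite bnd_simp !add0r.
  by rewrite lef_pV2 ?posrE ?ltr0n// ler_nat ltnS.
- by move=> x; exact: powR_ge0.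
move=> n; rewrite add0r; have [nm|nm] := ltP n.+1%:R^-1 m.
  rewrite integral_powR// ?gt_eqF// lee_fin.
  by rewrite ler_pM2r ?invr_gt0// gerBl powR_ge0.
apply: (@le_trans _ _ (\int[mu]_(x in [set m]) (x `^ p)%:E)%E).
  apply: ge0_subset_integral => //.
  - by apply/measurable_EFinP; exact: measurable_funS (measurable_powR _).
  - by move=> x _; rewrite lee_fin powR_ge0.
  - move=> x /=; rewrite in_itv/= => /andP[nx xm]; apply/eqP.
    by rewrite eq_le xm (le_trans nm).
by rewrite integral_set1 lee_fin divr_ge0 ?powR_ge0// ltW.
Qed.

Lemma integrable_powRy (p : R) : p < -1 ->
  mu.-integrable `[1, +oo[ (fun u => (u `^ p)%:E).
Proof.
move=> p1; have p10 : p + 1 < 0 by rewrite -ltrBrDr sub0r.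
rewrite itv_bndy_bigcup_BRight.
apply: (@integrable_bigcup_bounded _ _ (- (p + 1)^-1)) => //.
- by move=> i j ij; apply/subsetPset/subset_itvl; rewrite bnd_simp lerD2l ler_nat.
- by move=> x; exact: powR_ge0.
move=> [|n].
  by rewrite addr0 set_itv1 integral_set1 lee_fin oppr_ge0 invr_le0 ltW.
rewrite integral_powR ?lt_eqF// ?ltrDl ?ltr0n// lee_fin powR1/=.
rewrite -invrN -[_ / (p + 1)]opprK -mulrN -invrN mulrC -mulrN opprB.
by rewrite ler_piMr ?invr_ge0 ?oppr_ge0 ?(ltW p10)// gerBl powR_ge0.
Qed.

End powers.

(** * The mixture of exponentials behind the power kernel *)

Section power_kernel.
Context {R : realType}.
Notation mu := (@lebesgue_measure R).
Implicit Types b x y u : R.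

(** [u^{-1-b} du] is, up to a constant, the Levy measure of a [b]-stable
    subordinator when [b < 1]. *)
Definition levy_kernel b x y u : R :=
  (1 - expR (- (x * u))) * (1 - expR (- (y * u))) * u `^ (- 1 - b).

Definition levy_integral b x y : R := \int[mu]_(u in `]0, +oo[) levy_kernel b x y u.

Lemma onem_expRN_ge0 x : 0 <= x -> 0 <= 1 - expR (- x).
Proof. by move=> x0; rewrite subr_ge0 -expR0 ler_expR oppr_le0. Qed.

Lemma onem_expRN_le1 x : 1 - expR (- x) <= 1.
Proof. by rewrite gerBl expR_ge0. Qed.

Lemma onem_expRN_le x : 1 - expR (- x) <= x.
Proof. by rewrite lerBlDr -lerBlDl -[_ - x]/(1 + - x) expR_ge1Dx. Qed.

Lemma levy_kernel_ge0 b x y u : 0 < x -> 0 < y -> 0 < u -> 0 <= levy_kernel b x y u.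
Proof.
move=> x0 y0 u0; rewrite mulr_ge0 ?powR_ge0//.
by rewrite mulr_ge0 ?onem_expRN_ge0// mulr_ge0// ltW.
Qed.

Lemma measurable_levy_kernel b x y : measurable_fun setT (levy_kernel b x y).
Proof.
have mexp z : measurable_fun setT (fun u => 1 - expR (- (z * u))).
  apply: measurable_funB => //; apply: measurableT_comp; first exact: measurable_expR.
  by apply: measurable_funN; exact: mulrl_measurable.
apply: measurable_funM; last exact: measurable_powR.
by apply: measurable_funM.
Qed.

(** Near [0] the kernel is at most [x y u^{1-b}], integrable as [b < 2]; at infinity
    it is at most [u^{-1-b}], integrable as [b > 0]. *)
Lemma integrable_levy_kernel b x y : 0 < b -> b < 2 -> 0 < x -> 0 < y ->
  mu.-integrable `]0, +oo[ (EFin \o levy_kernel b x y).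
Proof.
move=> b0 b2 x0 y0.
have -> : `]0, +oo[%classic = `]0, 1[%classic `|` `[1, +oo[%classic :> set R.
  by rewrite -itv_bndbnd_setU ?bnd_simp ?ler01.
have mf D : measurable_fun D (levy_kernel b x y).
  exact: measurable_funS (measurable_levy_kernel b x y).
apply: integrable_disjointU => //.
- apply/disj_setPLR => u /=; rewrite !in_itv/= => /andP[_ u1].
  by rewrite andbT leNgt u1.
- apply: (@integrable_dominated _ _ (fun u => x * y * u `^ (1 - b))) => //.
  + exact: mf.
  + move=> u /=; rewrite in_itv/= => /andP[u0 u1].
    rewrite ger0_norm ?levy_kernel_ge0//.
    rewrite (_ : 1 - b = 2 + (- 1 - b)); last by ring.
    rewrite powRD ?(gt_eqF u0) ?implybT// powR_mulrn; last exact: ltW.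
    rewrite mulrA ler_wpM2r ?powR_ge0// expr2 mulrACA.
    by apply: ler_pM; rewrite ?onem_expRN_ge0 ?onem_expRN_le// mulr_ge0// ltW.
  + rewrite (_ : _ \o _ = (fun u => ((x * y)%:E * (u `^ (1 - b))%:E)%E)).
    by apply: integrableZl => //; apply: integrable_powR0; lra.
  by apply/funext => u /=; rewrite EFinM.
- apply: (@integrable_dominated _ _ (fun u => u `^ (- 1 - b))) => //.
  + exact: mf.
  + move=> u /=; rewrite in_itv/= andbT => u1.
    have u0 : 0 < u by exact: lt_le_trans u1.
    rewrite ger0_norm ?levy_kernel_ge0// ler_piMl ?powR_ge0//.
    by apply: mulr_ile1; rewrite ?onem_expRN_ge0 ?onem_expRN_le1// mulr_ge0// ltW.
  + by apply: integrable_powRy; lra.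
Qed.

(** Substitution [u := k u]. *)
Lemma levy_integral_scale b k x y : 0 < b -> b < 2 -> 0 < k -> 0 < x -> 0 < y ->
  levy_integral b (k * x) (k * y) = k `^ b * levy_integral b x y.
Proof.
move=> b0 b2 k0 x0 y0.
rewrite /levy_integral (@Rintegral_affine _ k 0 `]0, +oo[ (levy_kernel b x y)) ?gt_eqF//.
- have -> : (fun u => k * u + 0) @^-1` `]0, +oo[ = `]0, +oo[%classic.
    by apply/seteqP; split => u /=; rewrite !in_itv/= !andbT addr0 pmulr_rgt0.
  rewrite gtr0_norm//.
  transitivity (k `^ b * k * \int[mu]_(u in `]0, +oo[)
     (k `^ (- 1 - b) * levy_kernel b (k * x) (k * y) u)).
    rewrite RintegralZl//; last by apply: integrable_levy_kernel; rewrite ?mulr_gt0.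
    have -> : k `^ (- 1 - b) = (k `^ b * k)^-1.
      by rewrite -[X in _ * X](powRr1 (ltW k0)) -powRD ?(gt_eqF k0) ?implybT// -powRN opprD addrC.
    by rewrite mulrA mulfV ?mul1r// mulf_neq0 ?gt_eqF ?powR_gt0.
  rewrite mulrA; congr (_ * _); apply: eq_Rintegral => u.
  rewrite inE/= in_itv/= andbT => u0.
  rewrite /levy_kernel addr0 powRM ?ltW// !(mulrA _ k u) [x * k]mulrC [y * k]mulrC.
  by ring.
- by move=> u /=; rewrite in_itv/= andbT => u0; exact: levy_kernel_ge0.
- exact: integrable_levy_kernel.
Qed.

Lemma levy_integral_gt0 b : 0 < b -> b < 2 -> 0 < levy_integral b 1 1.
Proof.
move=> b0 b2; pose c := (1 - expR (- 1)) ^+ 2 * 2 `^ (- 1 - b) : R.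
have e1 : expR (- 1) < 1 :> R by rewrite -{2}expR0 ltr_expR ltrN10.
have c0 : 0 < c by rewrite mulr_gt0 ?powR_gt0// exprn_gt0// subr_gt0.
have fi := @integrable_levy_kernel b 1 1 b0 b2 ltr01 ltr01.
apply: (@lt_le_trans _ _ c) => //.
have -> : c = \int[mu]_(u in `]0, +oo[) ((fun=> c) \_ `[1, 2]) u.
  rewrite -Rintegral_mkcondr (_ : _ `&` _ = `[1, 2]%classic).
    rewrite Rintegral_cst//= lebesgue_measure_itv/= lte_fin ltr1n/=.
    by rewrite -[2]/(1 + 1) addrK mulr1.
  apply/setIidr => u /=; rewrite !in_itv/= andbT => /andP[u1 _].
  exact: lt_le_trans u1.
apply: le_Rintegral => //.
  rewrite -restrict_EFin; apply/integrable_restrict => //.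
  apply: (@integrableS _ _ _ mu `[1, 2]) => //.
    exact: measurableI.
  apply: continuous_compact_integrable; first exact: segment_compact.
  by apply: continuous_subspaceT => ?; exact: cvg_cst.
move=> u /=; rewrite in_itv/= andbT patchE => u0.
case: ifPn => [|_]; last exact: levy_kernel_ge0.
rewrite inE/= in_itv/= => /andP[u1 u2].
rewrite /levy_kernel mul1r -expr2 ler_pM ?powR_ge0 ?sqr_ge0//.
- by rewrite lerXn2r ?nnegrE ?onem_expRN_ge0 ?(ltW u0)// lerB// ler_expR lerN2.
- rewrite -opprD !powRN lef_pV2 ?posrE ?powR_gt0//.
  by apply: ge0_ler_powR; rewrite ?nnegrE// ?(ltW u0)//; lra.
Qed.

(** The [J] of the introduction is a symmetric 2-cocycle, homogeneous of degree [b];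
    doubling the arguments exhibits [(2 - 2^b) J] as the coboundary of a multiple
    of [x^b]. *)
Lemma levy_integral_power_kernel b x y : 0 < b -> b < 2 -> 0 < x -> 0 < y ->
  (2 - 2 `^ b) * levy_integral b x y =
  levy_integral b 1 1 * (x `^ b + y `^ b - (x + y) `^ b).
Proof.
move=> b0 b2 x0 y0.
have diag z : 0 < z -> levy_integral b z z = z `^ b * levy_integral b 1 1.
  by move=> z0; rewrite -levy_integral_scale// mulr1.
have xy0 : 0 < x + y by exact: addr_gt0.
have := @levy_integral_scale b 2 x y b0 b2 ltac:(by []) x0 y0.
have : levy_integral b x x + levy_integral b y y + levy_integral b (2 * x) (2 * y) =
    levy_integral b x y + levy_integral b x y + levy_integral b (x + y) (x + y).
  have i2x : 0 < 2 * x by rewrite mulr_gt0.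
  have i2y : 0 < 2 * y by rewrite mulr_gt0.
  have ki u v : 0 < u -> 0 < v -> mu.-integrable `]0, +oo[ (EFin \o levy_kernel b u v).
    exact: integrable_levy_kernel.
  have kD u v w z : 0 < u -> 0 < v -> 0 < w -> 0 < z ->
      mu.-integrable `]0, +oo[ (EFin \o (fun s => levy_kernel b u v s + levy_kernel b w z s)).
    move=> u0 v0 w0 z0; rewrite (_ : _ \o _ = ((EFin \o levy_kernel b u v) \+
        (EFin \o levy_kernel b w z))%E).
      by apply: integrableD => //; exact: ki.
    by apply/funext => s /=; rewrite EFinD.
  have m0y : measurable (`]0, +oo[%classic : set (measurableTypeR R)) by [].
  rewrite /levy_integral -(RintegralD m0y (ki _ _ x0 x0) (ki _ _ y0 y0)).
  rewrite -(RintegralD m0y (kD _ _ _ _ x0 x0 y0 y0) (ki _ _ i2x i2y)).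
  rewrite -(RintegralD m0y (ki _ _ x0 y0) (ki _ _ x0 y0)).
  rewrite -(RintegralD m0y (kD _ _ _ _ x0 y0 x0 y0) (ki _ _ xy0 xy0)).
  apply: eq_Rintegral => u _; rewrite /levy_kernel.
  have exp2 z : expR (- (2 * z * u)) = expR (- (z * u)) ^+ 2.
    by rewrite expr2 -expRD; congr expR; ring.
  have -> : expR (- ((x + y) * u)) = expR (- (x * u)) * expR (- (y * u)).
    by rewrite -expRD; congr expR; ring.
  by rewrite !exp2; ring.
rewrite (diag x)// (diag y)// (diag (x + y))// => + e; rewrite e => {}e.
by rewrite !mulrBr !mulrDr; lra.
Qed.

End power_kernel.

(** * Positive definiteness of the power kernel *)

Lemma le0_ger_powR (R : realType) (r x y : R) :
  r <= 0 -> 0 < x -> x <= y -> y `^ r <= x `^ r.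
Proof.
move=> r0 x0 xy; have y0 := lt_le_trans x0 xy.
rewrite -[r]opprK (powRN x) (powRN y) lef_pV2 ?posrE ?powR_gt0//.
by apply: ge0_ler_powR; rewrite ?oppr_ge0 ?nnegrE ?(ltW x0) ?(ltW y0).
Qed.

(** [b |-> 2^b] is increasing and equals [2] at [b = 1]. *)
Lemma two_sub_powR_div_gt0 (R : realType) (b : R) : b != 1 -> 0 < (2 - 2 `^ b) / (1 - b).
Proof.
move=> b1; have ln2 : 0 < ln (2 : R) by rewrite ln_gt0// ltr1n.
have e2 : 2 = expR (1 * ln 2) :> R by rewrite mul1r lnK ?posrE.
have -> : 2 `^ b = expR (b * ln 2) by rewrite /powR pnatr_eq0.
rewrite {1}e2; have [lt1|gt1|/eqP] := ltgtP b 1; last by rewrite (negbTE b1).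
  by rewrite divr_gt0// subr_gt0// ltr_expR ltr_pM2r.
by rewrite -mulrNN -invrN divr_gt0// oppr_gt0 subr_lt0// ltr_expR ltr_pM2r.
Qed.

Definition power_kernel (R : realType) (b x y : R) : R :=
  (1 - b)^-1 * (y `^ b + x `^ b - (x + y) `^ b).

(** Rank one for [b = 0] and [b = 2], and otherwise a positive multiple of the
    integral of the rank-one kernels [(1 - e^{-xu}) (1 - e^{-yu})]. *)
Lemma power_kernel_psd (R : realType) (b : R) n (x c : 'I_n -> R) :
  0 <= b <= 2 -> b != 1 -> (forall i, 0 < x i) ->
  0 <= \sum_(i < n) \sum_(j < n) c i * c j * power_kernel b (x i) (x j).
Proof.
move=> /andP[b_ge0 b_le2] b1 x0.
have rank1 (f : R -> R) : (forall i j, power_kernel b (x i) (x j) = f (x i) * f (x j)) ->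
    0 <= \sum_(i < n) \sum_(j < n) c i * c j * power_kernel b (x i) (x j).
  move=> kE; rewrite (_ : \sum_(i < n) _ = (\sum_(i < n) c i * f (x i)) ^+ 2).
    exact: sqr_ge0.
  rewrite expr2 big_distrlr/=; apply: eq_bigr => i _; apply: eq_bigr => j _.
  by rewrite kE; ring.
have [b0|b0] := eqVneq b 0.
  apply: (rank1 (fun=> 1)) => i j.
  by rewrite /power_kernel b0 !powRr0 subr0 invr1; ring.
have [b2|b2] := eqVneq b 2.
  apply: (rank1 (fun t => Num.sqrt 2 * t)) => i j.
  rewrite mulrACA -expr2 sqr_sqrtr ?ler0n// /power_kernel b2.
  rewrite !powR_mulrn ?(ltW (x0 _)) ?addr_ge0 ?(ltW (x0 _))//.
  by field.
have {b0}b_gt0 : 0 < b by rewrite lt_neqAle eq_sym b0.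
have {b2}b_lt2 : b < 2 by rewrite lt_neqAle b2.
pose C := (2 - 2 `^ b) / (1 - b) / levy_integral b 1 1.
have C0 : 0 < C by rewrite divr_gt0 ?levy_integral_gt0 ?two_sub_powR_div_gt0.
have kE i j : power_kernel b (x i) (x j) = C * levy_integral b (x i) (x j).
  have J0 := levy_integral_gt0 b_gt0 b_lt2.
  have nb : 1 - b != 0 by rewrite subr_eq0 eq_sym.
  have J1 := lt0r_neq0 J0.
  have -> : C * levy_integral b (x i) (x j) =
      (1 - b)^-1 / levy_integral b 1 1 * ((2 - 2 `^ b) * levy_integral b (x i) (x j)).
    by rewrite /C; field; rewrite J1.
  by rewrite levy_integral_power_kernel// /power_kernel; field; rewrite J1.
have -> : \sum_(i < n) \sum_(j < n) c i * c j * power_kernel b (x i) (x j) =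
    C * \sum_(i < n) \sum_(j < n) c i * c j * levy_integral b (x i) (x j).
  rewrite mulr_sumr; apply: eq_bigr => i _; rewrite mulr_sumr.
  by apply: eq_bigr => j _; rewrite kE mulrCA.
apply: mulr_ge0; first exact: ltW.
apply: Rintegral_quad_ge0 => //.
  by move=> i j; exact: integrable_levy_kernel.
move=> u _; rewrite (_ : \sum_(i < n) _ =
    (\sum_(i < n) c i * (1 - expR (- (x i * u)))) ^+ 2 * u `^ (- 1 - b)).
  by rewrite mulr_ge0 ?sqr_ge0 ?powR_ge0.
rewrite expr2 big_distrlr/= mulr_suml; apply: eq_bigr => i _.
rewrite mulr_suml; apply: eq_bigr => j _.
by rewrite /levy_kernel; ring.
Qed.

(** * Integrability of beta-type functions *)

Section covariance_integrand.
Context {R : realType}.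
Notation mu := (@lebesgue_measure R).
Implicit Types a b w z s : R.

(** A bound that covers both signs of [b]: the first term dominates when [b <= 0],
    the second when [b > 0]. *)
Lemma le_powR_add b x y M : 0 < x -> x <= y -> y <= M ->
  y `^ b <= x `^ b + M `^ b :> R.
Proof.
move=> x0 xy yM; have y0 := lt_le_trans x0 xy.
have [b0|b0] := leP b 0.
  by rewrite (le_trans (le0_ger_powR b0 x0 xy))// lerDl powR_ge0.
rewrite (@le_trans _ _ (M `^ b)) ?lerDr ?powR_ge0//.
by apply: ge0_ler_powR; rewrite ?nnegrE ?(ltW b0) ?(ltW y0) ?(le_trans (ltW y0) yM).
Qed.

(** Reflection [s := w - s] of the singularity at [0]. *)
Lemma integrable_powR_refl b w : -1 < b ->
  mu.-integrable `]0, w[ (fun s => ((w - s) `^ b)%:E).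
Proof.
move=> b1.
have <- : (fun x => -1 * x + w) @^-1` `]0, w[ = `]0, w[%classic.
  by apply/seteqP; split => s /=; rewrite !in_itv/= => /andP[? ?]; apply/andP; split; lra.
have <- : (fun s => ((- 1 * s + w) `^ b)%:E) = (fun s => ((w - s) `^ b)%:E).
  by apply/funext => s; rewrite mulN1r addrC.
apply: (@integrable_affine _ _ _ _ (fun s => s `^ b)) => //.
- by move=> x _; exact: powR_ge0.
- exact: integrable_powR0.
Qed.

Lemma measurable_powR_affine b k c D :
  measurable_fun D (fun s : R => (k * s + c) `^ b).
Proof.
apply: (@measurable_funS _ _ _ _ setT) => //.
apply: (measurableT_comp (measurable_powR _)).
by apply: measurable_funD => //; exact: mulrl_measurable.
Qed.

Lemma integrable_lincomb (D : set (measurableTypeR R)) (k l : R) (f g : R -> R) :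
  measurable D -> mu.-integrable D (EFin \o f) -> mu.-integrable D (EFin \o g) ->
  mu.-integrable D (EFin \o (fun s => k * f s + l * g s)).
Proof.
move=> mD fi gi.
rewrite (_ : _ \o _ = ((fun s => k%:E * (f s)%:E) \+ (fun s => l%:E * (g s)%:E))%E).
  by apply: integrableD => //; exact: integrableZl.
by apply/funext => s /=; rewrite EFinD !EFinM.
Qed.

(** The two singularities are separated at the midpoint: on the left half
    [(w - s)^b] is bounded, on the right half [s^a] is. *)
Lemma integrable_beta a b w : -1 < a -> -1 < b ->
  mu.-integrable `]0, w[ (EFin \o (fun s => s `^ a * (w - s) `^ b)).
Proof.
move=> a1 b1.
apply: (@integrable_dominated _ _ (fun s => ((w / 2) `^ b + w `^ b) * s `^ a +
    ((w / 2) `^ a + w `^ a) * (w - s) `^ b)) => //.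
- apply: measurable_funM; first exact: measurable_funS (measurable_powR _).
  have <- : (fun s => (- 1 * s + w) `^ b) = (fun s => (w - s) `^ b).
    by apply/funext => s; rewrite mulN1r addrC.
  exact: measurable_powR_affine.
- move=> s /=; rewrite in_itv/= => /andP[s0 sw].
  have w0 : 0 < w by exact: lt_trans sw.
  rewrite ger0_norm ?mulr_ge0 ?powR_ge0//.
  have [sw2|sw2] := leP s (w / 2).
    rewrite ler_wpDr ?mulr_ge0 ?addr_ge0 ?powR_ge0// mulrC.
    by rewrite ler_wpM2r ?powR_ge0// le_powR_add//; lra.
  rewrite ler_wpDl ?mulr_ge0 ?addr_ge0 ?powR_ge0//.
  by rewrite ler_wpM2r ?powR_ge0// le_powR_add//; lra.
- by apply: integrable_lincomb => //; [exact: integrable_powR0|exact: integrable_powR_refl].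
Qed.

(** The three terms of the integrand of [Q] have the form [s^a (k s + c)^b] with
    [k s + c] between [w - s] and a constant. *)
Lemma integrable_beta_affine a b w M k c : -1 < a -> -1 < b ->
  (forall s, 0 < s < w -> w - s <= k * s + c <= M) ->
  mu.-integrable `]0, w[ (EFin \o (fun s => s `^ a * (k * s + c) `^ b)).
Proof.
move=> a1 b1 kcP.
apply: (@integrable_dominated _ _ (fun s => 1 * (s `^ a * (w - s) `^ b) +
    M `^ b * (s `^ a))) => //.
- apply: measurable_funM; first exact: measurable_funS (measurable_powR _).
  exact: measurable_powR_affine.
- move=> s /=; rewrite in_itv/= => sw.
  have /andP[s0 sw'] := sw; have /andP[kc1 kc2] := kcP s sw.
  rewrite ger0_norm ?mulr_ge0 ?powR_ge0// mul1r [M `^ b * _]mulrC -mulrDr.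
  by rewrite ler_wpM2l ?powR_ge0// le_powR_add// subr_gt0.
- by apply: integrable_lincomb => //; [exact: integrable_beta|exact: integrable_powR0].
Qed.

End covariance_integrand.

(** * The covariance function *)

Section covariance.
Context {R : realType}.
Notation mu := (@lebesgue_measure R).
Implicit Types a b w z s : R.

Definition Q_integrand a b w z s : R :=
  s `^ a * ((z - s) `^ b + (w - s) `^ b - (w + z - s *+ 2) `^ b).

Lemma integrable_Q_terms a b w z : -1 < a -> -1 < b -> w <= z ->
  [/\ mu.-integrable `]0, w[ (EFin \o (fun s => s `^ a * (z - s) `^ b)),
      mu.-integrable `]0, w[ (EFin \o (fun s => s `^ a * (w - s) `^ b)) &
      mu.-integrable `]0, w[ (EFin \o (fun s => s `^ a * (w + z - s *+ 2) `^ b))].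
Proof.
move=> a1 b1 wz; split.
- have -> : (fun s => s `^ a * (z - s) `^ b) = (fun s => s `^ a * (- 1 * s + z) `^ b).
    by apply/funext => s; congr (_ * _ `^ b); ring.
  apply: (@integrable_beta_affine _ _ _ _ z) => // s /andP[s0 sw].
  by apply/andP; split; lra.
- exact: integrable_beta.
- have -> : (fun s => s `^ a * (w + z - s *+ 2) `^ b) =
      (fun s => s `^ a * (- 2 * s + (w + z)) `^ b).
    by apply/funext => s; congr (_ * _ `^ b); ring.
  apply: (@integrable_beta_affine _ _ _ _ (w + z)) => // s /andP[s0 sw].
  by apply/andP; split; lra.
Qed.

Lemma integrable_Q_integrand a b w z : -1 < a -> -1 < b -> w <= z ->
  mu.-integrable `]0, w[ (EFin \o Q_integrand a b w z).
Proof.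
move=> a1 b1 wz; have [i1 i2 i3] := integrable_Q_terms a1 b1 wz.
have i12 := @integrable_lincomb R `]0, w[ 1 1 _ _ (measurable_itv _) i1 i2.
have := @integrable_lincomb R `]0, w[ 1 (-1) _ _ (measurable_itv _) i12 i3.
by apply: eq_integrable => // s _ /=; congr EFin; rewrite /Q_integrand; ring.
Qed.

Lemma Q_integrandC a b w z : Q_integrand a b w z = Q_integrand a b z w.
Proof.
apply/funext => s; rewrite /Q_integrand.
by rewrite [w + z]addrC [(z - s) `^ b + _]addrC.
Qed.

Lemma QE a b w z : Q a b w z =
  (1 - b)^-1 * \int[mu]_(s in `]0, Num.min w z[) Q_integrand a b w z s.
Proof. by rewrite (minC w z). Qed.

Lemma Q_sym a b w z : Q a b w z = Q a b z w.
Proof. by rewrite !QE (minC z w) (Q_integrandC a b z w). Qed.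

Lemma Q0 a b z : 0 <= z -> Q a b 0 z = 0.
Proof. by move=> z0; rewrite QE min_l// set_itvoo0 Rintegral_set0 mulr0. Qed.

Lemma integrable_Q a b w z : -1 < a -> -1 < b ->
  mu.-integrable `]0, Num.min w z[ (EFin \o Q_integrand a b w z).
Proof.
move=> a1 b1; have [wz|zw] := orP (le_total w z).
  by rewrite min_l//; exact: integrable_Q_integrand.
by rewrite min_r// Q_integrandC; exact: integrable_Q_integrand.
Qed.

Lemma Q_integrand_power_kernel a b w z :
  (fun s => s `^ a * power_kernel b (w - s) (z - s)) =
  (fun s => (1 - b)^-1 * Q_integrand a b w z s).
Proof.
apply/funext => s; rewrite /power_kernel /Q_integrand mulrCA.
by congr (_ * (_ * (_ - _ `^ b))); ring.
Qed.

Lemma Q_power_kernel a b w z : -1 < a -> -1 < b ->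
  Q a b w z = \int[mu]_s
    ((fun s => s `^ a * power_kernel b (w - s) (z - s)) \_ `]0, Num.min w z[) s.
Proof.
move=> a1 b1; rewrite -Rintegral_mkcond Q_integrand_power_kernel QE.
by rewrite (RintegralZl _ _ (integrable_Q w z a1 b1)).
Qed.

Lemma integrable_power_kernel a b w z : -1 < a -> -1 < b ->
  mu.-integrable setT (EFin \o
    ((fun s => s `^ a * power_kernel b (w - s) (z - s)) \_ `]0, Num.min w z[)).
Proof.
move=> a1 b1; rewrite -restrict_EFin; apply/integrable_restrict; rewrite ?setTI//.
rewrite Q_integrand_power_kernel.
rewrite (_ : _ \o _ = (fun s => ((1 - b)^-1)%:E * (EFin \o Q_integrand a b w z) s))%E.
  by apply: integrableZl => //; exact: integrable_Q.
by apply/funext => s /=; rewrite EFinM.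
Qed.

(** * Nonnegative exponents *)

(** For fixed [s > 0] only the points [t i > s] contribute, through the power kernel
    at the points [t i - s]. *)
Lemma Q_psd_of_power_kernel a b n (t c : 'I_n -> R) : -1 < a -> 0 <= b <= 2 -> b != 1 ->
  0 <= \sum_(i < n) \sum_(j < n) c i * c j * Q a b (t i) (t j).
Proof.
move=> a1 b02 b1; have bN1 : -1 < b by case/andP: b02 => ? _; lra.
under eq_bigr do under eq_bigr do rewrite Q_power_kernel//.
apply: Rintegral_quad_ge0 => //; first by move=> i j; exact: integrable_power_kernel.
move=> s _.
have [s0|s0] := leP s 0.
  apply: sumr_ge0 => i _; apply: sumr_ge0 => j _; rewrite patchE.
  case: ifPn => [|_]; last by rewrite mulr0.
  by rewrite inE/= in_itv/= ltNge s0.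
(* the default 1 only keeps the point positive; its weight is 0 *)
pose x i := if s < t i then t i - s else 1.
pose c' i := if s < t i then c i else 0.
have -> : \sum_(i < n) \sum_(j < n) c i * c j *
    ((fun s => s `^ a * power_kernel b (t i - s) (t j - s)) \_ `]0, Num.min (t i) (t j)[) s =
  s `^ a * \sum_(i < n) \sum_(j < n) c' i * c' j * power_kernel b (x i) (x j).
  rewrite mulr_sumr; apply: eq_bigr => i _; rewrite mulr_sumr; apply: eq_bigr => j _.
  rewrite patchE /c' /x; case: ifPn; rewrite (inE, notin_setE)/= in_itv/= s0/= lt_min.
    by move=> /andP[-> ->]; rewrite mulrCA.
  by move=> /negP; case: ifP => _; case: ifP => _ //; rewrite ?mul0r ?mulr0 ?mul0r ?mulr0.
rewrite mulr_ge0 ?powR_ge0//; apply: power_kernel_psd => // i.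
by rewrite /x; case: ifPn => // ?; rewrite subr_gt0.
Qed.

(** * Negative exponents *)

(** Convexity of [x^b], read off the factorization
    [x^b - (x + h)^b = x^b (1 - (1 + h/x)^b)]: both factors are nonnegative and
    nonincreasing in [x]. *)
Lemma powR_drop_antitone b h x y : b <= 0 -> 0 <= h -> 0 < x -> x <= y ->
  y `^ b - (y + h) `^ b <= x `^ b - (x + h) `^ b.
Proof.
move=> b0 h0 x0 xy; have y0 := lt_le_trans x0 xy.
have factor v : 0 < v -> v `^ b - (v + h) `^ b = v `^ b * (1 - (1 + h / v) `^ b).
  move=> v0; rewrite mulrBr mulr1 -powRM ?(ltW v0) ?addr_ge0 ?divr_ge0 ?(ltW v0)//.
  by congr (_ - _ `^ b); field; rewrite gt_eqF.
rewrite !factor//; apply: ler_pM; rewrite ?powR_ge0 ?le0_ger_powR//.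
  have one : 1 `^ b = 1 :> R by rewrite powR1.
  rewrite subr_ge0 -[leRHS]one.
  by rewrite le0_ger_powR// lerDl divr_ge0// ltW.
rewrite lerB// le0_ger_powR//; first by rewrite ltr_wpDr// divr_ge0// ltW.
by rewrite lerD2l ler_wpM2l// lef_pV2 ?posrE.
Qed.

(** The substitution [s := k s] with [k = w'/w >= 1] multiplies the integral by
    [k^{a+b+1} >= 1]. *)
Lemma beta_integral_mono a b w w' : -1 < a -> -1 < b -> 0 <= a + b + 1 ->
  0 <= w -> w <= w' ->
  \int[mu]_(s in `]0, w[) (s `^ a * (w - s) `^ b) <=
  \int[mu]_(s in `]0, w'[) (s `^ a * (w' - s) `^ b).
Proof.
move=> a1 b1 ab; rewrite le_eqVlt => /predU1P[<- w'0|w0 ww'].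
  rewrite set_itvoo0 Rintegral_set0; apply: Rintegral_ge0 => s _.
  by rewrite mulr_ge0 ?powR_ge0.
pose k := w' / w.
have k1 : 1 <= k by rewrite ler_pdivlMr// mul1r.
have k0 : 0 < k := lt_le_trans ltr01 k1.
have kw : k * w = w' by rewrite divfK ?gt_eqF.
clearbody k.
rewrite [leRHS](@Rintegral_affine _ k 0) ?gt_eqF//; last 2 first.
- by move=> s _; rewrite mulr_ge0 ?powR_ge0.
- exact: integrable_beta.
have -> : (fun s => k * s + 0) @^-1` `]0, w'[ = `]0, w[%classic.
  by apply/seteqP; split => s /=; rewrite !in_itv/= addr0 -kw ltr_pM2l// pmulr_rgt0.
have -> : \int[mu]_(s in `]0, w[) ((k * s + 0) `^ a * (w' - (k * s + 0)) `^ b) =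
    k `^ a * k `^ b * \int[mu]_(s in `]0, w[) (s `^ a * (w - s) `^ b).
  rewrite -RintegralZl//; last exact: integrable_beta.
  apply: eq_Rintegral => s; rewrite inE/= in_itv/= => /andP[s0 sw].
  rewrite addr0 -kw -mulrBr !powRM ?subr_ge0 ?(ltW s0) ?(ltW sw) ?(ltW k0)//.
  by rewrite mulrACA.
rewrite gtr0_norm// mulrA ler_peMl//.
  by apply: Rintegral_ge0 => s _; rewrite mulr_ge0 ?powR_ge0.
rewrite -[X in X * _](powRr1 (ltW k0)) -!powRD ?(gt_eqF k0) ?implybT//.
by rewrite -[leLHS](powRr0 k) ler_powR//; lra.
Qed.

(** With [h = z' - z] and [g x = x^b - (x + h)^b], the difference
    [Q(v, z) - Q(v, z')] is, up to the factor [1/(1-b)], the integral over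
    [0 < s < v] of [s^a (g(z - s) - g(v + z - 2s))]. As [g] is nonincreasing, this
    integrand is nonnegative and grows with [v], and so does its domain. *)
Lemma Q_increment_le0 a b w w' z z' : -1 < a -> -1 < b -> b < 0 ->
  0 <= w -> w <= w' -> w' <= z -> z <= z' -> rect_increment (Q a b) w w' z z' <= 0.
Proof.
move=> a1 bN1 b0 w0 ww' w'z zz'.
have wz := le_trans ww' w'z; have wz' := le_trans wz zz'.
have w'z' := le_trans w'z zz'.
pose E v s := Q_integrand a b v z s - Q_integrand a b v z' s.
have intE v : v <= z -> mu.-integrable `]0, v[ (EFin \o E v).
  move=> vz; have i1 := integrable_Q_integrand a1 bN1 vz.
  have i2 := integrable_Q_integrand a1 bN1 (le_trans vz zz').
  have := @integrable_lincomb R `]0, v[ 1 (-1) _ _ (measurable_itv _) i1 i2.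
  by apply: eq_integrable => // s _ /=; congr EFin; rewrite /E; ring.
have IE v : v <= z -> Q a b v z - Q a b v z' = (1 - b)^-1 * \int[mu]_(s in `]0, v[) E v s.
  move=> vz; rewrite !QE !min_l// ?(le_trans vz)// -mulrBr; congr (_ * _).
  by rewrite -RintegralB//; exact: integrable_Q_integrand (le_trans vz _).
have EE v s : E v s = s `^ a * (((z - s) `^ b - (z - s + (z' - z)) `^ b) -
    ((v + z - s *+ 2) `^ b - (v + z - s *+ 2 + (z' - z)) `^ b)).
  rewrite /E /Q_integrand.
  rewrite (_ : z - s + (z' - z) = z' - s); last by ring.
  by rewrite (_ : v + z - s *+ 2 + (z' - z) = v + z' - s *+ 2); ring.
have combine (q1 q2 q3 q4 k i i' : R) : q1 - q2 = k * i -> q3 - q4 = k * i' ->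
    0 <= k -> i <= i' -> q4 - q2 - q3 + q1 <= 0.
  move=> e e' k0 ii'; rewrite (_ : _ + _ = (q1 - q2) - (q3 - q4)); last by ring.
  by rewrite e e' subr_le0 ler_wpM2l.
apply: (combine _ _ _ _ _ _ _ (IE w wz) (IE w' w'z)).
  by rewrite invr_ge0 subr_ge0 (le_trans (ltW b0)).
apply: le_Rintegral_extend => //; [exact: intE|exact: intE| |].
- move=> s /andP[s0 sw]; rewrite !EE ler_wpM2l ?powR_ge0// lerB//.
  by apply: powR_drop_antitone; lra.
- move=> s /andP[ws sw']; rewrite EE mulr_ge0 ?powR_ge0// subr_ge0.
  by apply: powR_drop_antitone; lra.
Qed.

(** Split off the beta integral [int_0^w s^a (w-s)^b ds], which is nondecreasing in
    [w]. What remains has the integrand [s^a ((z-s)^b - (w+z-2s)^b)], nonnegative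
    and nondecreasing in [w] because [b < 0]. *)
Lemma Q_mono a b w w' z : -1 < a -> -1 < b -> b < 0 -> 0 <= a + b + 1 ->
  0 <= w -> w <= w' -> w' <= z -> Q a b w z <= Q a b w' z.
Proof.
move=> a1 bN1 b0 ab w0 ww' w'z; have wz := le_trans ww' w'z.
pose E v s := s `^ a * (z - s) `^ b - s `^ a * (v + z - s *+ 2) `^ b.
have intE v : v <= z -> mu.-integrable `]0, v[ (EFin \o E v).
  move=> vz; have [i1 _ i3] := integrable_Q_terms a1 bN1 vz.
  have := @integrable_lincomb R `]0, v[ 1 (-1) _ _ (measurable_itv _) i1 i3.
  by apply: eq_integrable => // s _ /=; congr EFin; rewrite /E; ring.
have IE v : v <= z -> \int[mu]_(s in `]0, v[) Q_integrand a b v z s =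
    \int[mu]_(s in `]0, v[) E v s + \int[mu]_(s in `]0, v[) (s `^ a * (v - s) `^ b).
  move=> vz; rewrite -RintegralD//; [|exact: intE|exact: integrable_beta].
  by apply: eq_Rintegral => s _; rewrite /Q_integrand /E; ring.
rewrite [leLHS]QE [leRHS]QE (min_l wz) (min_l w'z); apply: ler_wpM2l.
  by rewrite invr_ge0 subr_ge0 (le_trans (ltW b0)).
rewrite [leLHS](IE w wz) [leRHS](IE w' w'z).
apply: lerD; last exact: beta_integral_mono.
apply: le_Rintegral_extend => //; [exact: intE|exact: intE| |].
- move=> s /andP[s0 sw]; rewrite lerB// ler_wpM2l ?powR_ge0//.
  by apply: le0_ger_powR; lra.
- move=> s /andP[ws sw']; rewrite subr_ge0 ler_wpM2l ?powR_ge0//.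
  by apply: le0_ger_powR; lra.
Qed.

End covariance.

Unset Implicit Arguments.

Theorem theorem2p5 (R : realType) (a b : R)
    (ha : -1 < a) (hb : -1 < b) (hb1 : b != 1) :
  (0 <= b <= 2 -> positive_definite (Q a b)) /\
  (b < 0 -> 0 <= a + b + 1 -> positive_definite (Q a b)).
Proof.
split=> [b02|b0 ab]; split.
- by move=> s t _ _; exact: Q_sym.
- by move=> n t c _ _; exact: Q_psd_of_power_kernel.
- by move=> s t _ _; exact: Q_sym.
- move=> n t c _ t0.
  apply: (@nonpositive_increments_psd _ (Q a b) _ _ _ _ n t c t0).
  + by move=> z; exact: Q0.
  + by move=> w z _ _; exact: Q_sym.
  + by move=> w w' z z'; exact: Q_increment_le0.
  + by move=> w w' z; exact: Q_mono.
Qed.
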